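(* Let $\mathbf{C}$ be a category with all coproducts and let $(M,\eta,\mu)$ be a monad on $\mathbf{C}$. Let $M^{\mathrm{s}} := \mathrm{id}_{\mathbf{C}} + M$, $\eta^{\mathrm{s}} := \mathsf{inl}^{\mathrm{id}+M} : \mathrm{id}_{\mathbf{C}} \Rightarrow M^{\mathrm{s}}$, and $\mu^{\mathrm{s}} := [\mathrm{id}_{\mathrm{id}+M},\ \mathsf{inr}^{\mathrm{id}+M}\circ \mu\circ M[\eta,\mathrm{id}_M]] : M^{\mathrm{s}}M^{\mathrm{s}} \Rightarrow M^{\mathrm{s}}$. Then the triple $(M^{\mathrm{s}},\eta^{\mathrm{s}},\mu^{\mathrm{s}})$ is a monad on $\mathbf{C}$.
   Context: Coproducts of endofunctors are pointwise: $(F+G)X = FX+GX$ and $(F+G)f = Ff+Gf$, with injections $\mathsf{inl}^{F+G}_X : FX\to FX+GX$ and $\mathsf{inr}^{F+G}_X: GX \to FX+GX$. The notation $[k_1,k_2]$ denotes the copairing, i.e. the unique map with $[k_1,k_2]\circ\mathsf{inl}=k_1$ and $[k_1,k_2]\circ\mathsf{inr}=k_2$. In components, $M^{\mathrm{s}}X = X+MX$, $M^{\mathrm{s}}M^{\mathrm{s}}X = (X+MX)+M(X+MX)$, $\eta^{\mathrm{s}}_X=\mathsf{inl}: X\to X+MX$, and $\mu^{\mathrm{s}}_X=[\mathrm{id}_{X+MX},\ \mathsf{inr}\circ\mu_X\circ M[\eta_X,\mathrm{id}_{MX}]]$. *)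

(* Defs.v *)
From Corelib Require Import ssreflect.

Set Implicit Arguments.
Unset Strict Implicit.
Unset Printing Implicit Defensive.

Declare Scope cat_scope.
Delimit Scope cat_scope with cat.
Local Open Scope cat_scope.

Reserved Notation "g \o f" (at level 50, format "g  \o '/ '  f").

Record category := Category {
  obj :> Type;
  hom : obj -> obj -> Type;
  idm : forall X, hom X X;
  comp : forall X Y Z, hom Y Z -> hom X Y -> hom X Z;
  comp1m : forall X Y (f : hom X Y), comp (idm Y) f = f;
  compm1 : forall X Y (f : hom X Y), comp f (idm X) = f;
  compA : forall X Y Z W (h : hom Z W) (g : hom Y Z) (f : hom X Y),
    comp h (comp g f) = comp (comp h g) f
}.
Arguments hom {c} X Y.
Arguments idm {c} X.

Notation "g \o f" := (comp g f) : cat_scope.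

Record functor (C D : category) := Functor {
  fobj :> C -> D;
  fmap : forall X Y : C, hom X Y -> hom (fobj X) (fobj Y);
  fmap1 : forall X, fmap (idm X) = idm (fobj X);
  fmapM : forall X Y Z (g : hom Y Z) (f : hom X Y),
    fmap (g \o f) = fmap g \o fmap f
}.
Arguments fmap {C D} F {X Y} f : rename.

Definition functor_id (C : category) : functor C C :=
  @Functor C C (fun X => X) (fun _ _ f => f)
    (fun _ => eq_refl) (fun _ _ _ _ _ => eq_refl).

Section FunctorComp.
Variables (C D E : category) (G : functor D E) (F : functor C D).

Let comp_map (X Y : C) (f : hom X Y) : hom (G (F X)) (G (F Y)) :=
  fmap G (fmap F f).

Lemma functor_comp1 X : comp_map (idm X) = idm (G (F X)).
Proof. by rewrite /comp_map !fmap1. Qed.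

Lemma functor_compM X Y Z (g : hom Y Z) (f : hom X Y) :
  comp_map (g \o f) = comp_map g \o comp_map f.
Proof. by rewrite /comp_map !fmapM. Qed.

Definition functor_comp : functor C E :=
  @Functor C E (fun X => G (F X)) comp_map functor_comp1 functor_compM.

End FunctorComp.

(* A transformation is a bare family of components: naturality is a separate
   predicate, which [is_monad] requires of both the unit and the
   multiplication. *)
Definition transf (C D : category) (F G : functor C D) :=
  forall X : C, hom (F X) (G X).

Definition natural (C D : category) (F G : functor C D) (a : transf F G) :=
  forall (X Y : C) (f : hom X Y), fmap G f \o a X = a Y \o fmap F f.

Record is_monad (C : category) (M : functor C C)
    (eta : transf (functor_id C) M) (mu : transf (functor_comp M M) M) :
    Prop := IsMonad {
  monad_eta_natural : natural eta;
  monad_mu_natural : natural mu;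
  monad_unitl : forall X : C, mu X \o eta (M X) = idm (M X);
  monad_unitr : forall X : C, mu X \o fmap M (eta X) = idm (M X);
  monad_assoc : forall X : C, mu X \o mu (M X) = mu X \o fmap M (mu X)
}.

Record coproduct (C : category) (I : Type) (A : I -> C) := Coproduct {
  cop_obj :> C;
  cop_inj : forall i, hom (A i) cop_obj;
  cop_desc : forall Y : C, (forall i, hom (A i) Y) -> hom cop_obj Y;
  cop_descK : forall Y (k : forall i, hom (A i) Y) i,
    cop_desc k \o cop_inj i = k i;
  cop_desc_uniq : forall Y (k : forall i, hom (A i) Y) (h : hom cop_obj Y),
    (forall i, h \o cop_inj i = k i) -> h = cop_desc k
}.

(* A (choice of) coproduct for every small family; the universe of the index
   types is independent of those of objects and morphisms. *)
Definition all_coproducts (C : category) :=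
  forall (I : Type) (A : I -> C), coproduct A.

Section BinaryCoproduct.
Variables (C : category) (S : all_coproducts C).
Implicit Types X Y Z W : C.

Definition pair_family X Y (b : bool) : C := if b then X else Y.

Definition bcop X Y : C := S (pair_family X Y).

Definition binl X Y : hom X (bcop X Y) := cop_inj (S (pair_family X Y)) true.

Definition binr X Y : hom Y (bcop X Y) := cop_inj (S (pair_family X Y)) false.

Definition copair X Y Z (f : hom X Z) (g : hom Y Z) : hom (bcop X Y) Z :=
  cop_desc (S (pair_family X Y))
    (fun b => match b return hom (pair_family X Y b) Z with
              | true => f
              | false => g
              end).

Lemma copair_binl X Y Z (f : hom X Z) (g : hom Y Z) :
  copair f g \o binl X Y = f.
Proof. exact: (cop_descK (S (pair_family X Y)) _ true). Qed.

Lemma copair_binr X Y Z (f : hom X Z) (g : hom Y Z) :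
  copair f g \o binr X Y = g.
Proof. exact: (cop_descK (S (pair_family X Y)) _ false). Qed.

Lemma copair_uniq X Y Z (f : hom X Z) (g : hom Y Z) (h : hom (bcop X Y) Z) :
  h \o binl X Y = f -> h \o binr X Y = g -> h = copair f g.
Proof. by move=> hf hg; apply: cop_desc_uniq; case. Qed.

End BinaryCoproduct.

Section FunctorCoproduct.
Variables (C D : category) (S : all_coproducts D) (F G : functor C D).

Let sum_map (X Y : C) (f : hom X Y) :
    hom (bcop S (F X) (G X)) (bcop S (F Y) (G Y)) :=
  copair S (binl S (F Y) (G Y) \o fmap F f) (binr S (F Y) (G Y) \o fmap G f).

Lemma functor_sum1 X : sum_map (idm X) = idm (bcop S (F X) (G X)).
Proof.
symmetry; apply: copair_uniq; by rewrite fmap1 comp1m compm1.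
Qed.

Lemma functor_sumM X Y Z (g : hom Y Z) (f : hom X Y) :
  sum_map (g \o f) = sum_map g \o sum_map f.
Proof.
symmetry; apply: copair_uniq; rewrite -compA.
- by rewrite copair_binl compA copair_binl -compA fmapM.
- by rewrite copair_binr compA copair_binr -compA fmapM.
Qed.

Definition functor_sum : functor C D :=
  @Functor C D (fun X => bcop S (F X) (G X)) sum_map functor_sum1 functor_sumM.

Definition inl_transf : transf F functor_sum := fun X => binl S (F X) (G X).

Definition inr_transf : transf G functor_sum := fun X => binr S (F X) (G X).

End FunctorCoproduct.

Section MonadS.
Variables (C : category) (S : all_coproducts C) (M : functor C C).

Definition Ms : functor C C := functor_sum S (functor_id C) M.

Definition eta_s : transf (functor_id C) Ms := inl_transf S (functor_id C) M.

Definition mu_s (eta : transf (functor_id C) M)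
    (mu : transf (functor_comp M M) M) : transf (functor_comp Ms Ms) Ms :=
  fun X =>
    copair S (idm (Ms X))
      (inr_transf S (functor_id C) M X
         \o (mu X \o fmap M (copair S (eta X) (idm (M X))))).

End MonadS.

(* Main.v *)
(** The copairing [s = [eta, id] : id + M => M] is natural and satisfies
    [s \o mu^s = mu \o M s \o s], i.e. it is a morphism of monads once [M^s] is
    known to be one.  On the left summand of [M^s M^s X] the monad laws for
    [M^s] are immediate; on the right summand these two properties of [s]
    reduce them to the laws for [M]. *)
From Corelib Require Import ssreflect.
Require Import Defs.

Set Implicit Arguments.
Unset Strict Implicit.
Unset Printing Implicit Defensive.

Local Open Scope cat_scope.

Section FreeUnit.
Variables (C : category) (S : all_coproducts C) (M : functor C C).
Variables (eta : transf (functor_id C) M) (mu : transf (functor_comp M M) M).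
Hypothesis HM : is_monad eta mu.

Local Notation T := (Ms S M).
Local Notation inl X := (binl S X (M X)).
Local Notation inr X := (binr S X (M X)).
Local Notation mus := (mu_s S eta mu).

(** The injections are jointly epic, so each equation out of [T X] below splits into one check per
    summand. *)
Lemma Ms_ext X Y (f g : hom (T X) Y) :
  f \o inl X = g \o inl X -> f \o inr X = g \o inr X -> f = g.
Proof.
move=> fgl fgr; rewrite (copair_uniq fgl fgr).
by symmetry; apply: copair_uniq.
Qed.

Definition unit_copair (X : C) : hom (T X) (M X) :=
  copair S (eta X) (idm (M X)).

Local Notation s := unit_copair.

Lemma unit_copair_inl X : s X \o inl X = eta X.
Proof. exact: copair_binl. Qed.

Lemma unit_copair_inr X : s X \o inr X = idm (M X).
Proof. exact: copair_binr. Qed.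

Lemma fmap_Ms_inl X Y (f : hom X Y) : fmap T f \o inl X = inl Y \o f.
Proof. exact: copair_binl. Qed.

Lemma fmap_Ms_inr X Y (f : hom X Y) : fmap T f \o inr X = inr Y \o fmap M f.
Proof. exact: copair_binr. Qed.

Lemma mu_s_inl X : mus X \o inl (T X) = idm (T X).
Proof. exact: copair_binl. Qed.

Lemma mu_s_inr X : mus X \o inr (T X) = inr X \o (mu X \o fmap M (s X)).
Proof. exact: copair_binr. Qed.

(** This and [mu_nat] unfold the actions of the identity and composite functors, so that the
    naturality squares can be used as rewrite rules. *)
Lemma eta_nat X Y (f : hom X Y) : fmap M f \o eta X = eta Y \o f.
Proof. exact: (monad_eta_natural HM). Qed.

Lemma mu_nat X Y (f : hom X Y) :
  fmap M f \o mu X = mu Y \o fmap M (fmap M f).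
Proof. exact: (monad_mu_natural HM). Qed.

Lemma unit_copair_nat X Y (f : hom X Y) :
  fmap M f \o s X = s Y \o fmap T f.
Proof.
apply: Ms_ext; rewrite -!compA.
- by rewrite unit_copair_inl fmap_Ms_inl compA unit_copair_inl eta_nat.
- by rewrite unit_copair_inr fmap_Ms_inr compA unit_copair_inr comp1m compm1.
Qed.

(** On the left summand, naturality of [eta] at [s X] brings in [mu X \o eta (M X)], which cancels
    by a unit law of [M]; on the right summand both sides become [mu X \o fmap M (s X)]. *)
Lemma unit_copair_mu X : s X \o mus X = mu X \o (fmap M (s X) \o s (T X)).
Proof.
apply: Ms_ext; rewrite -!compA.
- rewrite mu_s_inl unit_copair_inl eta_nat compA.
  by rewrite (monad_unitl HM) comp1m compm1.
- by rewrite mu_s_inr unit_copair_inr (compA (s X)) unit_copair_inr comp1m compm1.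
Qed.

Lemma mu_s_natural : natural mus.
Proof.
move=> X Y f; change (fmap T f \o mus X = mus Y \o fmap T (fmap T f)).
apply: Ms_ext; rewrite -!compA.
- by rewrite mu_s_inl fmap_Ms_inl compA mu_s_inl comp1m compm1.
- rewrite mu_s_inr fmap_Ms_inr !compA fmap_Ms_inr mu_s_inr -!compA.
  (* Naturality of [s] under [M] carries [f] past [s]; naturality of [mu] carries it past [mu]. *)
  by rewrite -fmapM -unit_copair_nat fmapM !(compA (fmap M f)) mu_nat -!compA.
Qed.

Lemma mu_s_unitr X : mus X \o fmap T (inl X) = idm (T X).
Proof.
apply: Ms_ext; rewrite -compA comp1m.
- by rewrite fmap_Ms_inl compA mu_s_inl comp1m.
(* Under [M], [s X \o inl X] collapses to [eta X], leaving [mu X \o fmap M (eta X)]. *)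
- rewrite fmap_Ms_inr compA mu_s_inr -!compA -fmapM unit_copair_inl.
  by rewrite (monad_unitr HM) compm1.
Qed.

Lemma mu_s_assoc X : mus X \o mus (T X) = mus X \o fmap T (mus X).
Proof.
apply: Ms_ext; rewrite -!compA.
- by rewrite mu_s_inl fmap_Ms_inl compA mu_s_inl comp1m compm1.
- rewrite mu_s_inr fmap_Ms_inr !compA mu_s_inr -!compA -fmapM unit_copair_mu.
  (* Once [mu] is moved to the left of [fmap M (s X)], both sides end in the same maps [fmap M (fmap
     M (s X)) \o fmap M (s (T X))], and associativity of [mu] remains. *)
  rewrite !fmapM !(compA (fmap M (s X))) mu_nat -!compA.
  by rewrite !(compA (mu X)) (monad_assoc HM).
Qed.

End FreeUnit.

Theorem theorem3p3 (C : category) (S : all_coproducts C) (M : functor C C)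
    (eta : transf (functor_id C) M) (mu : transf (functor_comp M M) M)
    (HM : is_monad eta mu) :
  is_monad (eta_s S M) (mu_s S eta mu).
Proof.
split.
- by move=> X Y f; apply: fmap_Ms_inl.
- exact: mu_s_natural.
- by move=> X; apply: mu_s_inl.
- by move=> X; apply: mu_s_unitr.
- by move=> X; apply: mu_s_assoc.
Qed.
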